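(* Let $X$ be a Banach space. If for every $\delta>0$ there exists a Banach space $Y$ which is isomorphic to $X$ such that $d(X,Y)<1+\delta$ and $Y$ has the Daugavet property, then $X$ also has the Daugavet property.
   Context: All Banach spaces are nontrivial and real. A Banach space $X$ has the Daugavet property if $\|I+T\|=1+\|T\|$ for every rank-one bounded linear operator $T:X\to X$. The Banach--Mazur distance between isomorphic Banach spaces $X$ and $Y$ is $d(X,Y)=\inf\{\|L\|\|L^{-1}\|: L:X\to Y\text{ is an isomorphism}\}$. *)

(* Defs.v *)
From HB Require Import structures.
From mathcomp Require Import all_boot all_order all_algebra.
From mathcomp Require Import boolp classical_sets reals.
From mathcomp Require Import topology normedtype.

Set Implicit Arguments.
Unset Strict Implicit.
Unset Printing Implicit Defensive.

Import Order.TTheory GRing.Theory Num.Theory.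
Import numFieldNormedType.Exports.

Local Open Scope classical_set_scope.
Local Open Scope ring_scope.

Definition nontrivial_space (R : realType) (X : normedModType R) : Prop :=
  exists x : X, x != 0.

Definition bounded_operator (R : realType) (X Y : normedModType R)
    (f : X -> Y) : Prop :=
  bounded_near f (nbhs (0 : X)).

(* A real number; [sup] returns a junk value when [f] is not bounded on the
   unit ball. *)
Definition opnorm (R : realType) (X Y : normedModType R) (f : X -> Y) : R :=
  sup [set `|f x| | x in [set x : X | `|x| <= 1]].

Definition rank_one (R : realType) (X Y : normedModType R)
    (T : {linear X -> Y}) : Prop :=
  exists2 y : Y, y != 0 & range T = range (fun a : R => a *: y).

Definition Daugavet_property (R : realType) (X : completeNormedModType R) :
    Prop :=
  forall T : {linear X -> X}, bounded_operator T -> rank_one T ->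
    opnorm (idfun \+ T) = 1 + opnorm T.

(* [L] is an isomorphism of Banach spaces and [M] is its inverse. *)
Definition isomorphism_with_inverse (R : realType)
    (X Y : completeNormedModType R)
    (L : {linear X -> Y}) (M : {linear Y -> X}) : Prop :=
  [/\ bounded_operator L, bounded_operator M, cancel L M & cancel M L].

Definition isomorphic_spaces (R : realType) (X Y : completeNormedModType R) :
    Prop :=
  exists (L : {linear X -> Y}) (M : {linear Y -> X}),
    isomorphism_with_inverse L M.

(* Only meaningful for isomorphic spaces: otherwise this is the infimum of the
   empty set, which is [0] by convention. *)
Definition Banach_Mazur_distance (R : realType)
    (X Y : completeNormedModType R) : R :=
  inf [set r : R | exists (L : {linear X -> Y}) (M : {linear Y -> X}),
    isomorphism_with_inverse L M /\ r = opnorm L * opnorm M].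

(* Main.v *)
Require Import Defs.
From HB Require Import structures.
From mathcomp Require Import all_boot all_order all_algebra.
From mathcomp Require Import boolp classical_sets reals.
From mathcomp Require Import topology normedtype.
From mathcomp Require Import lra.

Set Implicit Arguments.
Unset Strict Implicit.

Import Order.TTheory GRing.Theory Num.Theory.
Import numFieldNormedType.Exports.

Local Open Scope ring_scope.

(** Transport a rank-one [T] on [X] to [S = L T L^-1] on [Y], again of rank
    one. With [c = |L| |L^-1|] one has [|I + S| <= c |I + T|] and
    [|T| <= c |S|], so that [|I + S| = 1 + |S|] yields
    [1 + |T| <= c^2 |I + T|]; then let [c] tend to [1]. *)

(** By homogeneity a bound near the origin scales to the whole space; the proofs below use
    boundedness in this form. *)
Lemma bounded_operatorP (R : realType) (X Y : normedModType R)
    (f : {linear X -> Y}) :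
  bounded_operator f <-> exists2 c, 0 < c & forall x, `|f x| <= c * `|x|.
Proof.
split=> [/linear_boundedP/pinfty_ex_gt0[c c0 fc]|[c c0 fc]]; first by exists c.
apply/linear_boundedP; exists c; split; first exact: gtr0_real.
by move=> r cr x; rewrite (le_trans (fc x))// ler_wpM2r// ltW.
Qed.

Lemma opnorm_le (R : realType) (X Y : normedModType R) (f : X -> Y) (c : R) :
  0 <= c -> (forall x, `|f x| <= c * `|x|) -> opnorm f <= c.
Proof.
move=> c0 fc; apply: ge_sup.
  by exists `|f 0|; exists 0 => //=; rewrite normr0.
move=> _ [x /= x1 <-]; rewrite (le_trans (fc x))//.
by rewrite -[leRHS]mulr1 ler_wpM2l.
Qed.

Lemma ler_opnorm (R : realType) (X Y : normedModType R) (f : {linear X -> Y}) :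
  bounded_operator f -> forall x, `|f x| <= opnorm f * `|x|.
Proof.
move=> /bounded_operatorP[c c0 fc] x.
have [->|x0] := eqVneq x 0; first by rewrite linear0 !normr0 mulr0.
have nx0 : 0 < `|x| by rewrite normr_gt0.
have fE : `|f (`|x|^-1 *: x)| = `|f x| / `|x|.
  by rewrite linearZ normrZ ger0_norm ?invr_ge0// mulrC.
(* The quotient is the value at a unit vector, so it lies below the supremum; [c] bounds the set, so
   [sup] is not a junk value. *)
rewrite -ler_pdivrMr// -fE; apply: ub_le_sup.
  exists c => _ [y /= y1 <-]; rewrite (le_trans (fc y))//.
  by rewrite -[leRHS]mulr1 ler_wpM2l// ltW.
exists (`|x|^-1 *: x) => //=.
by rewrite normrZ ger0_norm ?invr_ge0// mulVf// normr_eq0.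
Qed.

Lemma opnorm_ge0 (R : realType) (X Y : normedModType R) (f : {linear X -> Y}) :
  bounded_operator f -> 0 <= opnorm f.
Proof.
move=> /bounded_operatorP[c c0 fc]; apply: ub_le_sup.
  exists c => _ [y /= y1 <-]; rewrite (le_trans (fc y))//.
  by rewrite -[leRHS]mulr1 ler_wpM2l// ltW.
by exists 0; rewrite /= ?linear0 normr0.
Qed.

Lemma bounded_operator_comp (R : realType) (X Y Z : normedModType R)
    (f : {linear X -> Y}) (g : {linear Y -> Z}) :
  bounded_operator f -> bounded_operator g -> bounded_operator (g \o f).
Proof.
move=> /bounded_operatorP[c c0 fc] /bounded_operatorP[d d0 gd].
apply/(bounded_operatorP (g \o f)).
exists (d * c); first exact: mulr_gt0.
move=> x /=; rewrite (le_trans (gd _))// -mulrA ler_wpM2l//.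
exact: ltW.
Qed.

Lemma bounded_operator_idD (R : realType) (X : normedModType R)
    (f : {linear X -> X}) :
  bounded_operator f -> bounded_operator (idfun \+ f).
Proof.
move=> /bounded_operatorP[c c0 fc].
apply/(bounded_operatorP (idfun \+ f)).
exists (1 + c); first by rewrite addr_gt0.
by move=> x /=; rewrite (le_trans (ler_normD _ _))// mulrDl mul1r lerD2l.
Qed.

Lemma opnorm_comp (R : realType) (X Y Z : normedModType R)
    (f : {linear X -> Y}) (g : {linear Y -> Z}) :
  bounded_operator f -> bounded_operator g ->
  opnorm (g \o f) <= opnorm g * opnorm f.
Proof.
move=> bf bg; apply: opnorm_le => [|x /=].
  by rewrite mulr_ge0 ?opnorm_ge0.
rewrite (le_trans (ler_opnorm bg _))// -mulrA.
by rewrite ler_wpM2l ?opnorm_ge0 ?ler_opnorm.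
Qed.

Lemma opnorm_idD_le (R : realType) (X : normedModType R)
    (f : {linear X -> X}) :
  bounded_operator f -> opnorm (idfun \+ f) <= 1 + opnorm f.
Proof.
move=> bf; apply: opnorm_le => [|x /=]; first by rewrite addr_ge0 ?opnorm_ge0.
by rewrite (le_trans (ler_normD _ _))// mulrDl mul1r lerD2l ler_opnorm.
Qed.

Section isomorphism.
Context (R : realType) (X Y : completeNormedModType R).
Context (L : {linear X -> Y}) (M : {linear Y -> X}).
Hypothesis LM : isomorphism_with_inverse L M.

(** Evaluate [M (L x) = x] at a nonzero [x] and cancel its norm. *)
Lemma opnorm_iso_ge1 : nontrivial_space X -> 1 <= opnorm L * opnorm M.
Proof.
case: LM => bL bM LK MK [x x0].
have nx : 0 < `|x| by rewrite normr_gt0.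
rewrite -(ler_pM2r nx) mul1r -{1}(LK x) (le_trans (ler_opnorm bM _))//.
by rewrite (mulrC (opnorm L)) -mulrA ler_wpM2l ?opnorm_ge0 ?ler_opnorm.
Qed.

Lemma opnorm_conj_le (T : {linear X -> X}) : bounded_operator T ->
  opnorm (L \o T \o M) <= opnorm L * opnorm M * opnorm T.
Proof.
case: LM => bL bM LK MK bT.
rewrite (le_trans (opnorm_comp (g := L \o T) bM _))//.
  exact: bounded_operator_comp.
by rewrite mulrAC ler_wpM2r ?opnorm_ge0 ?opnorm_comp.
Qed.

(** As [M] is onto, the new range is the image under [L] of the line [range T]; it is spanned by
    [L y], nonzero because [L] is injective. *)
Lemma rank_one_conj (T : {linear X -> X}) :
  rank_one T -> rank_one (L \o T \o M).
Proof.
case: LM => bL bM LK MK [y y0 Ty]; exists (L y).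
  by apply: contra y0 => /eqP Ly0; rewrite -(LK y) Ly0 linear0.
rewrite eqEsubset; split=> [_ [z _ <-]|_ [a _ <-]].
  have : range T (T (M z)) by exists (M z).
  by rewrite Ty => -[a _ ay]; exists a => //=; rewrite -ay linearZ.
have [x _ xE] : range T (a *: y) by rewrite Ty; exists a.
by exists (L x) => //=; rewrite LK xE linearZ.
Qed.

Lemma Daugavet_iso_bound (T : {linear X -> X}) :
  nontrivial_space X -> Daugavet_property Y ->
  bounded_operator T -> rank_one T ->
  1 + opnorm T <= (opnorm L * opnorm M) ^+ 2 * opnorm (idfun \+ T).
Proof.
move=> X0 DY bT rT; have [bL bM LK MK] := LM.
have c1 := opnorm_iso_ge1 X0; set c := _ * _ in c1 *.
pose S : {linear Y -> Y} := L \o T \o M.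
have bS : bounded_operator S.
  by do 2 apply: bounded_operator_comp => //.
have DS := DY S bS (rank_one_conj rT).
(* Since [L \o M] is the identity, adding the identity commutes with conjugation, so
   [opnorm_conj_le] applies to [idfun \+ T] too. *)
have SE : idfun \+ S = L \o (idfun \+ T) \o M.
  by apply/funext => y /=; rewrite linearD MK.
have TE : T = M \o S \o L :> (X -> X).
  by apply/funext => x /=; rewrite !LK.
have leS : 1 + opnorm S <= c * opnorm (idfun \+ T).
  rewrite -DS SE; apply: (opnorm_conj_le (T := idfun \+ T)).
  exact: bounded_operator_idD.
have leT : opnorm T <= c * opnorm S.
  rewrite TE (le_trans (opnorm_comp (g := M \o S) bL _))//.
    exact: bounded_operator_comp.
  by rewrite mulrC /c -mulrA ler_wpM2l ?opnorm_ge0// opnorm_comp.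
have c0 : 0 <= c := le_trans ler01 c1.
(* Multiply [leS] by [c]: the left side [c + c * opnorm S] dominates [1 + opnorm T] by [c1] and
   [leT]. *)
rewrite expr2 -mulrA (le_trans _ (ler_wpM2l c0 leS))//.
by rewrite mulrDr mulr1 lerD.
Qed.

End isomorphism.

(** The infimum need not be attained, but a strict upper bound is beaten by some member of the set,
    which an isomorphism makes nonempty. *)
Lemma Banach_Mazur_distance_lt (R : realType) (X Y : completeNormedModType R)
    (r : R) :
  isomorphic_spaces X Y -> Banach_Mazur_distance X Y < r ->
  exists (L : {linear X -> Y}) (M : {linear Y -> X}),
    isomorphism_with_inverse L M /\ opnorm L * opnorm M < r.
Proof.
move=> [L0 [M0 LM0]] /inf_lt[|_ [L [M [LM ->]]] LMr]; last by exists L, M.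
by exists (opnorm L0 * opnorm M0), L0, M0.
Qed.

Unset Implicit Arguments.
Set Strict Implicit.

Theorem corollary3p5 (R : realType) (X : completeNormedModType R)
    (X_nontrivial : nontrivial_space X)
    (X_approx : forall delta : R, 0 < delta ->
      exists Y : completeNormedModType R,
        [/\ nontrivial_space Y, isomorphic_spaces X Y,
            Banach_Mazur_distance X Y < 1 + delta & Daugavet_property Y]) :
  Daugavet_property X.
Proof.
(* The triangle inequality gives one half; the other is proved up to an arbitrary [e > 0]. *)
move=> T bT rT; apply/eqP; rewrite eq_le opnorm_idD_le//=.
apply/ler_addgt0Pr => e e0; set n := opnorm (_ \+ _).
have n0 : 0 <= n.
  by apply: (opnorm_ge0 (f := idfun \+ T)); exact: bounded_operator_idD.
(* For [delta <= 1], [(1 + delta)^2 n <= n + 3 delta n]. *)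
pose d := Num.min 1 (e / (3 * (n + 1))).
have d0 : 0 < d by rewrite lt_min ltr01 divr_gt0// mulr_gt0// ltr_wpDl.
have d1 : d <= 1 by rewrite ge_min lexx.
have de : d * (3 * (n + 1)) <= e.
  by rewrite -ler_pdivlMr ?mulr_gt0 ?ltr_wpDl// ge_min lexx orbT.
have [Y [_ XY dXY DY]] := X_approx d d0.
have [L [M [LM cd]]] := Banach_Mazur_distance_lt XY dXY.
have := Daugavet_iso_bound LM X_nontrivial DY bT rT.
have := opnorm_iso_ge1 LM X_nontrivial.
rewrite -/n; move: cd; set c := _ * _ => cd c1 /le_trans; apply.
(* Squaring [c < 1 + d] is legitimate because [c >= 1], and [d ^+ 2 <= d]. *)
have c2 : c ^+ 2 <= 1 + 3 * d by nra.
(* Here [3 * d * n <= d * (3 * (n + 1)) <= e]; the [n + 1] keeps the denominator in [d] positive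
   even if [n = 0]. *)
nra.
Qed.
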